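(* Let $T\ge 1$ be an integer, $0<c_1\le c_2$ real numbers, $\{R_k\}_{k\in N_T}$ a sequence of real symmetric positive definite $n\times n$ matrices, and $\{A_k\}_{k\in N_{T-1}},\{C_k\}_{k\in N_{T-1}}$ real $n\times n$ matrices. The system $x_{k+1}=A_kx_k+C_kx_kw_k$, $x_0\in\mathbb{R}^n$, $k\in N_{T-1}$, is finite-time stable with respect to $(c_1,c_2,T,\{R_k\}_{k\in N_T})$ if and only if there exists a sequence of symmetric matrices $\{P_k\}_{k\in N_T}$, with $P_k$ of size $2^kn\times 2^kn$, satisfying $$P_0=R_0^{-1},$$ $$P_{k+1}=\begin{bmatrix}(I_{2^k}\otimes A_k)P_k(I_{2^k}\otimes A_k') & (I_{2^k}\otimes A_k)P_k(I_{2^k}\otimes C_k')\\ (I_{2^k}\otimes C_k)P_k(I_{2^k}\otimes A_k') & (I_{2^k}\otimes C_k)P_k(I_{2^k}\otimes C_k')\end{bmatrix},\quad k\in N_{T-1},$$ $$P_k<\frac{c_2}{c_1}(I_{2^k}\otimes R_k^{-1}),\quad k\in N_T.$$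
   Context: $N_T:=\{0,1,\dots,T\}$. $M'$ is the transpose, $\otimes$ the Kronecker product, $I_m$ the $m\times m$ identity; $M<N$ for symmetric matrices means $N-M$ is positive definite. $\|x\|_R^2:=x'Rx$. $\{w_k\}_{k\in N_{T-1}}$ is a sequence of independent real random variables on a complete probability space with $E[w_k]=0$ and $E[w_kw_j]=\delta_{kj}$ (Kronecker delta); $x_0$ is deterministic. Finite-time stability: the system is finite-time stable with respect to $(c_1,c_2,T,\{R_k\}_{k\in N_T})$ if for every deterministic $x_0\in\mathbb{R}^n$, $\|x_0\|_{R_0}^2\le c_1$ implies $E\|x_k\|_{R_k}^2<c_2$ for all $k\in N_T$. *)

(* Defs.v *)
From HB Require Import structures.
From mathcomp Require Import all_boot all_order all_algebra.
From mathcomp Require Import mxtens.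
From mathcomp Require Import all_classical all_reals all_analysis.

Set Implicit Arguments.
Unset Strict Implicit.
Unset Printing Implicit Defensive.

Import Order.TTheory GRing.Theory Num.Theory.

Local Open Scope classical_set_scope.
Local Open Scope ring_scope.

Section Matrices.
Context {R : realType}.

Definition qform {n : nat} (W : 'M[R]_n) (x : 'cV[R]_n) : R :=
  (x^T *m W *m x) ord0 ord0.

Definition posdef {n : nat} (M : 'M[R]_n) : Prop :=
  M \is symmetricmx /\ forall v : 'cV[R]_n, v != 0 -> 0 < qform M v.

Definition loewner_lt {n : nat} (M N : 'M[R]_n) : Prop := posdef (N - M).

Lemma pow2_0_dim (n : nat) : (n = 2 ^ 0 * n)%N.
Proof. by rewrite expn0 mul1n. Qed.

Lemma pow2_S_dim (k n : nat) : (2 ^ k * n + 2 ^ k * n = 2 ^ k.+1 * n)%N.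
Proof. by rewrite addnn -mul2n mulnA -expnS. Qed.

(* I_(2^k) (x) M; the index of entry (i, j) of a Kronecker product is
   i * n + j, so this is block diagonal with 2^k copies of M. *)
Definition kron_id (k : nat) {n : nat} (M : 'M[R]_n) : 'M[R]_(2 ^ k * n) :=
  tensmx (1%:M : 'M[R]_(2 ^ k)) M.

(* The matrix P_(k+1) built from P = P_k, with A = A_k and C = C_k; the cast
   only identifies the dimensions 2^k n + 2^k n and 2^(k+1) n. *)
Definition lyap_step (k : nat) {n : nat} (A C : 'M[R]_n)
    (P : 'M[R]_(2 ^ k * n)) : 'M[R]_(2 ^ k.+1 * n) :=
  castmx (pow2_S_dim k n, pow2_S_dim k n)
    (block_mx (kron_id k A *m P *m kron_id k A^T)
              (kron_id k A *m P *m kron_id k C^T)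
              (kron_id k C *m P *m kron_id k A^T)
              (kron_id k C *m P *m kron_id k C^T)).

End Matrices.

Section Processes.
Context {d : measure_display} {Omega : measurableType d} {R : realType}.
Variable Pr : probability Omega R.

Definition mutually_independent {I : finType} (w : I -> {RV Pr >-> R}) : Prop :=
  forall (J : {set I}) (B : I -> set R),
    (forall i, i \in J -> measurable (B i)) ->
    Pr (\bigcap_(i in [set` J]) (w i @^-1` B i)) =
    (\prod_(i in J) Pr (w i @^-1` B i))%E.

(* The noise sequence is indexed by all of nat, but only w_0, ..., w_(T-1)
   are constrained. *)
Definition unit_white_noise (T : nat) (w : nat -> {RV Pr >-> R}) : Prop :=
  [/\ mutually_independent (fun k : 'I_T => w k),
      (forall k, (k < T)%N -> ('E_Pr[w k] = 0)%E) &
      (forall k j, (k < T)%N -> (j < T)%N ->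
         ('E_Pr[w k \* w j] = ((k == j)%:R)%:E)%E)].

Fixpoint state {n : nat} (A C : nat -> 'M[R]_n) (w : nat -> {RV Pr >-> R})
    (x0 : 'cV[R]_n) (k : nat) (om : Omega) : 'cV[R]_n :=
  if k is k'.+1 then
    let x := state A C w x0 k' om in
    A k' *m x + w k' om *: (C k' *m x)
  else x0.

(* X x0 is the trajectory with deterministic initial value x0. The expectation
   is taken in the extended reals, so the bound also asserts its finiteness. *)
Definition finite_time_stable {n : nat}
    (X : 'cV[R]_n -> nat -> Omega -> 'cV[R]_n)
    (c1 c2 : R) (T : nat) (W : nat -> 'M[R]_n) : Prop :=
  forall x0 : 'cV[R]_n, qform (W 0%N) x0 <= c1 ->
  forall k, (k <= T)%N ->
    ('E_Pr[fun om => qform (W k) (X x0 k om)] < c2%:E)%E.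

End Processes.

(* Main.v *)
Require Import Defs.
From HB Require Import structures.
From mathcomp Require Import all_boot all_order all_algebra.
From mathcomp Require Import mxtens.
From mathcomp Require Import all_classical all_reals all_analysis.
From mathcomp Require Import measurable_realfun ring lra.

Set Implicit Arguments.
Unset Strict Implicit.
Unset Printing Implicit Defensive.

Import Order.TTheory GRing.Theory Num.Theory.

Local Open Scope classical_set_scope.
Local Open Scope ring_scope.

(** The mean of a quadratic form of the state is a quadratic form of the initial
value: white noise kills the cross terms, so
[E x_(k+1)' Q x_(k+1) = E x_k' (A_k' Q A_k + C_k' Q C_k) x_k], and unrolling
this recursion gives [E x_k' Q x_k = x_0' Phi_k' (I (x) Q) Phi_k x_0], where
[Phi_k], of size [2^k n] by [n], stacks the [2^k] products obtained by choosing
[A_j] or [C_j] at each time [j < k] ([word_stack], [state_second_moment]).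

On the other side, the recursion on [P_k] is solved in closed form by
[P_k = Phi_k R_0^-1 Phi_k'] ([lyap_step_word_stack]), so the sequence is unique
and automatically symmetric. Two facts link the sides. By homogeneity,
stability at time [k] says that [Phi_k' (I (x) R_k) Phi_k < (c2 / c1) R_0]
([ellipsoid_bound_posdef]). And [M' K M < r G] is equivalent to
[M G^-1 M' < r K^-1], as both express that the block matrix with diagonal
[r G], [K^-1] and off-diagonal [M] is positive definite; a direct completion of
the square proves it ([posdef_congr_dual]). With [M = Phi_k], [K = I (x) R_k],
[G = R_0] and [r = c2 / c1] this is the bound on [P_k].

The probabilistic content is that the past is uncorrelated with the present
noise. Independence is given as a product rule on events, so it is carried
along by a class of functions, [future_free], whose mean over any event about
the noise at times [>= k] is proportional to the probability of that event.
The class is closed under sums, and multiplying by a function of [w_k] moves it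
from [k] to [k + 1] with the means multiplying ([future_free_mul_noise]); every
quadratic form of [x_k] belongs to it ([state_future_free]). *)

(** * Decoupling a factor from a random variable *)

Section decoupling.
Local Open Scope ereal_scope.
Import HBNNSimple.

(** The product rule on events [Y @^-1` B] extends to functions of [Y]: both
sides are monotone limits along simple approximations of [g], and for a simple
[g] they are linear combinations of the hypothesis. The set [D] is a parameter
so that the conclusion can be read over a further independent event. *)
Lemma ge0_integral_decouple d d' (X : measurableType d) (Z : measurableType d')
    (R : realType) (mu : {measure set X -> \bar R}) (D : set X) (f : X -> R)
    (Y : X -> Z) (c : R) (g : Z -> R) :
  measurable D -> measurable_fun setT f -> (forall x, (0 <= f x)%R) ->
  measurable_fun setT Y -> (0 <= c)%R ->
  (forall B, measurable B ->
     \int[mu]_(x in D `&` Y @^-1` B) (f x)%:E = c%:E * mu (Y @^-1` B)) ->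
  measurable_fun setT g -> (forall z, (0 <= g z)%R) ->
  \int[mu]_(x in D) (f x * g (Y x))%:E = c%:E * \int[mu]_x (g (Y x))%:E.
Proof.
move=> mD mf f0 mY c0 fY mg g0.
have mYB B : measurable B -> measurable (Y @^-1` B).
  by move=> mB; rewrite -[Y @^-1` B]setTI; exact: mY.
have /measurable_EFinP mef := mf.
have /measurable_EFinP meg := mg.
have mgn (h : {nnsfun Z >-> R}) : measurable_fun setT (h \o Y).
  exact: measurableT_comp.
pose h := nnsfun_approx measurableT meg.
have cvgh z : (h n z)%:E @[n --> \oo] --> (g z)%:E.
  apply: (@cvg_nnsfun_approx _ _ _ _ measurableT _ meg) => // ? _.
  by rewrite lee_fin.
have nd z : {homo (fun n => h n z) : m n / (m <= n)%N >-> (m <= n)%R}.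
  by move=> m n mn; exact/lefP/nd_nnsfun_approx.
have cvgL : \int[mu]_(x in D) (f x * h n (Y x))%:E @[n --> \oo] -->
    \int[mu]_(x in D) (f x * g (Y x))%:E.
  have -> : \int[mu]_(x in D) (f x * g (Y x))%:E =
      \int[mu]_(x in D) limn (fun n => (f x * h n (Y x))%:E).
    apply: eq_integral => x _; apply/esym/cvg_lim => //.
    under eq_fun do rewrite EFinM.
    by rewrite EFinM; apply: cvgeZl => //.
  apply: cvg_monotone_convergence => //.
  - move=> n; apply/measurable_EFinP/measurable_funM;
      apply: measurable_funTS => //; exact: mgn.
  - by move=> n x _; rewrite lee_fin mulr_ge0.
  - by move=> x _ m n mn; rewrite lee_fin ler_wpM2l// nd.
have cvgR : c%:E * \int[mu]_x (h n (Y x))%:E @[n --> \oo] -->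
    c%:E * \int[mu]_x (g (Y x))%:E.
  apply: cvgeZl => //.
  have -> : \int[mu]_x (g (Y x))%:E = \int[mu]_x limn (fun n => (h n (Y x))%:E).
    by apply: eq_integral => x _; apply/esym/cvg_lim.
  apply: cvg_monotone_convergence => //.
  - by move=> n; apply/measurable_EFinP; exact: mgn.
  - by move=> n x _; rewrite lee_fin.
  - by move=> x _ m n mn; rewrite lee_fin nd.
apply: (cvg_unique _ cvgL) => //.
rewrite (_ : (fun n => _) = (fun n => c%:E * \int[mu]_x (h n (Y x))%:E)) //.
apply/funext => n.
pose A_ k := Y @^-1` (h n @^-1` [set k]).
have mA k : measurable (A_ k) by exact: mYB.
have hYE x : (h n (Y x))%:E = \sum_(k \in range (h n)) (k * \1_(A_ k) x)%:E.
  by rewrite fsumEFin// -fimfunE.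
have k_ge0 k : k \in range (h n) -> (0 <= k)%R.
  by rewrite inE => -[z _ <-].
have kA_ge0 k x : (0 <= k * \1_(A_ k) x :> R)%R.
  by have := nnfun_muleindic_ge0 (h n) k (Y x).
have mkA k : measurable_fun setT (fun x => (k * \1_(A_ k) x)%:E).
  exact/measurable_EFinP/measurable_funM.
transitivity (\sum_(k \in range (h n)) k%:E * (c%:E * mu (A_ k))).
  transitivity (\int[mu]_(x in D) \sum_(k \in range (h n))
                 ((f x)%:E * (k * \1_(A_ k) x)%:E)).
    apply: eq_integral => x _; rewrite EFinM hYE ge0_mule_fsumr// => k.
    by rewrite lee_fin.
  rewrite ge0_integral_fsum//; last 2 first.
  - move=> k; apply: emeasurable_funM; first exact: measurable_funTS.
    exact: measurable_funTS.
  - by move=> k x _; rewrite -EFinM lee_fin mulr_ge0.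
  apply: eq_fsbigr => k /k_ge0 k0.
  rewrite -fY// integral_mkcondr -ge0_integralZl_EFin//; last 2 first.
  - by move=> x Dx; apply: erestrict_ge0 => y _; rewrite lee_fin.
  - by apply/measurable_restrict; [exact: mA|done|exact: measurable_funTS].
  by apply: eq_integral => x _; rewrite epatch_indic/= -!EFinM mulrCA.
under eq_fsbigr do rewrite muleCA.
rewrite -ge0_mule_fsumr; last first.
  move=> k; have [k0|k0] := leP 0%R k; first by rewrite mule_ge0.
  by rewrite /A_ preimage_nnfun0// preimage_set0 measure0 mule0.
congr (_ * _).
under [RHS]eq_integral do rewrite hYE.
rewrite ge0_integral_fsum//; last by move=> k x _; rewrite lee_fin.
apply: eq_fsbigr => k /k_ge0 k0.
under [RHS]eq_integral do rewrite EFinM.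
by rewrite ge0_integralZl_EFin ?integral_indic ?setIT//; exact/measurable_EFinP.
Qed.
End decoupling.

(** * Functions that do not see the future noise *)

Section future_free.
Local Open Scope ereal_scope.
Context (R : realType) (d : measure_display) (Omega : measurableType d)
  (Pr : probability Omega R) (T : nat) (w : nat -> {RV Pr >-> R}).

Definition future_event (k : nat) (B : nat -> set R) : set Omega :=
  \bigcap_(i in [set i | (k <= i < T)%N]) (w i @^-1` B i).

(** Such an [f] behaves like a function of [w_0, ..., w_(k-1)] with mean [m]; the
integral condition stands in for measurability with respect to the past and
avoids generated sigma-algebras. *)
Definition future_free_ge0 (k : nat) (f : Omega -> R) (m : R) : Prop :=
  [/\ measurable_fun setT f, forall om, (0 <= f om)%R &
      forall B, (forall i, measurable (B i)) ->
        \int[Pr]_(om in future_event k B) (f om)%:E =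
        m%:E * Pr (future_event k B)].

(** Signed functions enter as differences: multiplying the integral condition
by a function of [w_k] takes a nonnegative [f], and the condition on a signed
[f] would say nothing about its absolute value. *)
Definition future_free (k : nat) (f : Omega -> R) (m : R) : Prop :=
  exists f1 f2 m1 m2, [/\ future_free_ge0 k f1 m1, future_free_ge0 k f2 m2,
    f = (f1 \- f2)%R & m = (m1 - m2)%R].

Lemma measurable_future_event k B : (forall i, measurable (B i)) ->
  measurable (future_event k B).
Proof.
move=> mB; apply: bigcap_measurableType => i _.
by rewrite -[_ @^-1` _]setTI; exact: measurable_funP.
Qed.

Lemma future_eventT k : future_event k (fun=> setT) = setT.
Proof. by apply/seteqP; split => om. Qed.

Lemma future_eventS k B : (k < T)%N ->
  future_event k B = future_event k.+1 B `&` w k @^-1` B k.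
Proof.
move=> kT; apply/seteqP; split => [om H|om [H Hk] i /= /andP[ki iT]].
  split; last by apply: H; rewrite /= leqnn.
  by move=> i /= /andP[ki iT]; apply: H; rewrite /= (ltnW ki).
move: ki; rewrite leq_eqVlt => /predU1P[<-//|ki].
by apply: H; rewrite /= ki.
Qed.

Lemma prob_future_eventS k B : mutually_independent (fun k : 'I_T => w k) ->
  (k < T)%N -> (forall i, measurable (B i)) ->
  Pr (future_event k B) = Pr (w k @^-1` B k) * Pr (future_event k.+1 B).
Proof.
move=> indep kT mB.
have prodE j : Pr (future_event j B) =
    \prod_(i in [set i : 'I_T | (j <= i)%N]%SET) Pr (w i @^-1` B i).
  rewrite -(indep _ (fun i : 'I_T => B i)) => [|//]; congr (Pr _).
  apply/seteqP; split => om H.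
    by move=> i /=; rewrite inE => ji; apply: H; rewrite /= ji ltn_ord.
  move=> i /= /andP[ji iT].
  by have := H (Ordinal iT); rewrite /= inE; apply.
rewrite !prodE.
have -> : ([set i : 'I_T | (k <= i)%N] =
    Ordinal kT |: [set i : 'I_T | (k.+1 <= i)%N])%SET.
  by apply/setP => i; rewrite !inE leq_eqVlt eq_sym.
by rewrite big_setU1//= inE ltnn.
Qed.

Lemma future_free_ge0_integral k f m : future_free_ge0 k f m ->
  \int[Pr]_om (f om)%:E = m%:E.
Proof.
move=> [_ _ /(_ (fun=> setT))]; rewrite future_eventT probability_setT mule1.
exact.
Qed.

Lemma future_free_ge0_mean_ge0 k f m : future_free_ge0 k f m -> (0 <= m)%R.
Proof.
move=> fm; rewrite -lee_fin -(future_free_ge0_integral fm).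
by case: fm => _ f0 _; apply: integral_ge0 => om _; rewrite lee_fin.
Qed.

Lemma future_free_ge0_integrable k f m : future_free_ge0 k f m ->
  Pr.-integrable setT (EFin \o f).
Proof.
move=> fm; have fE := future_free_ge0_integral fm; case: fm => mf f0 _.
apply/integrableP; split; first exact/measurable_EFinP.
under eq_integral do rewrite /= ger0_norm//.
by rewrite fE ltry.
Qed.

Lemma future_free_expectation k f m : future_free k f m -> 'E_Pr[f] = m%:E.
Proof.
move=> [f1 [f2 [m1 [m2 [fm1 fm2 -> ->]]]]].
rewrite unlock.
under eq_integral do rewrite EFinB.
rewrite integralB_EFin//; [|exact: future_free_ge0_integrable fm1
                           |exact: future_free_ge0_integrable fm2].
by rewrite (future_free_ge0_integral fm1) (future_free_ge0_integral fm2).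
Qed.

Lemma future_free_ge0D k f g m p : future_free_ge0 k f m ->
  future_free_ge0 k g p -> future_free_ge0 k (f \+ g)%R (m + p)%R.
Proof.
move=> fm gp; have m0 := future_free_ge0_mean_ge0 fm.
have p0 := future_free_ge0_mean_ge0 gp.
case: fm gp => mf f0 If [mg g0 Ig]; split.
- exact: measurable_funD.
- by move=> om; rewrite addr_ge0.
- move=> B mB; under eq_integral do rewrite EFinD.
  rewrite ge0_integralD//; last 5 first.
  - exact: measurable_future_event.
  - by move=> om _; rewrite lee_fin.
  - by apply/measurable_EFinP; exact: measurable_funTS.
  - by move=> om _; rewrite lee_fin.
  - by apply/measurable_EFinP; exact: measurable_funTS.
  by rewrite If// Ig// EFinD ge0_muleDl ?lee_fin.
Qed.

Lemma future_freeD k f g m p : future_free k f m -> future_free k g p ->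
  future_free k (f \+ g)%R (m + p)%R.
Proof.
move=> [f1 [f2 [m1 [m2 [fm1 fm2 -> ->]]]]] [g1 [g2 [p1 [p2 [gp1 gp2 -> ->]]]]].
exists (f1 \+ g1)%R, (f2 \+ g2)%R, (m1 + p1)%R, (m2 + p2)%R; split.
- exact: future_free_ge0D.
- exact: future_free_ge0D.
- by apply/funext => om /=; ring.
- by ring.
Qed.

(** For [B] fixing an event after time [k], the events [w_k @^-1` B']
intersected with it are again events from time [k] on, so the hypothesis on [f]
provides the product rule that [ge0_integral_decouple] needs, with constant
[m * Pr (future_event k.+1 B)]. *)
Lemma future_free_ge0_mul_noise k f m (g : R -> R) s :
  mutually_independent (fun k : 'I_T => w k) -> (k < T)%N ->
  future_free_ge0 k f m -> measurable_fun setT g -> (forall r, (0 <= g r)%R) ->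
  \int[Pr]_om (g (w k om))%:E = s%:E ->
  future_free_ge0 k.+1 (fun om => f om * g (w k om))%R (m * s)%R.
Proof.
move=> indep kT fm mg g0 gs; have m0 := future_free_ge0_mean_ge0 fm.
case: fm => mf f0 If; split.
- by apply: measurable_funM => //; exact: measurableT_comp.
- by move=> om; rewrite mulr_ge0.
move=> B mB.
have fin : Pr (future_event k.+1 B) \is a fin_num.
  by apply: fin_num_measure; exact: measurable_future_event.
rewrite (@ge0_integral_decouple _ _ _ _ _ Pr _ f (w k)
  (m * fine (Pr (future_event k.+1 B))))//.
- by rewrite gs EFinM fineK// EFinM muleAC.
- exact: measurable_future_event.
- by rewrite mulr_ge0// fine_ge0.
(* The family [B] with its entry at [k], which the later event ignores, set
   to [B']. *)
move=> B' mB'; pose B1 i := if i == k then B' else B i.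
have mB1 i : measurable (B1 i) by rewrite /B1; case: ifP.
have B1E : future_event k.+1 B1 = future_event k.+1 B.
  apply: eq_bigcapr => i /= /andP[ki _]; by rewrite /B1 gtn_eqF.
have B1k : B1 k = B' by rewrite /B1 eqxx.
rewrite -B1E -{1}B1k -future_eventS// If// prob_future_eventS// B1k.
by rewrite EFinM B1E fineK// muleCA muleC -muleA muleC.
Qed.

(** Splitting both [f] and [g] into differences of nonnegative functions, with
[g = g^+ - g^-], reduces to [future_free_ge0_mul_noise] on the four products. *)
Lemma future_free_mul_noise k f m (g : R -> R) s :
  mutually_independent (fun k : 'I_T => w k) -> (k < T)%N ->
  future_free k f m -> measurable_fun setT g ->
  Pr.-integrable setT (fun om => (g (w k om))%:E) ->
  \int[Pr]_om (g (w k om))%:E = s%:E ->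
  future_free k.+1 (fun om => f om * g (w k om))%R (m * s)%R.
Proof.
move=> indep kT [f1 [f2 [m1 [m2 [fm1 fm2 fE mE]]]]] mg ig gs.
have ip : Pr.-integrable setT (EFin \o (g \o w k)^\+%R).
  exact: integrable_funrpos.
have im : Pr.-integrable setT (EFin \o (g \o w k)^\-%R).
  exact: integrable_funrneg.
pose sp := fine (\int[Pr]_om (g^\+%R (w k om))%:E).
pose sn := fine (\int[Pr]_om (g^\-%R (w k om))%:E).
have spE : \int[Pr]_om (g^\+%R (w k om))%:E = sp%:E.
  by rewrite fineK//; exact: (integrable_fin_num _ ip).
have snE : \int[Pr]_om (g^\-%R (w k om))%:E = sn%:E.
  by rewrite fineK//; exact: (integrable_fin_num _ im).
have gpn r : g r = (g^\+ r - g^\- r)%R by rewrite -[in LHS](funrposBneg g).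
have sE : s = (sp - sn)%R.
  apply: EFin_inj; rewrite -gs EFinB -spE -snE -integralB_EFin//.
  by apply: eq_integral => om _; rewrite gpn EFinB.
have mgp : measurable_fun setT g^\+%R by exact: measurable_funrpos.
have mgn : measurable_fun setT g^\-%R by exact: measurable_funrneg.
have Fp f' m' : future_free_ge0 k f' m' -> _ := fun H =>
  future_free_ge0_mul_noise indep kT H mgp (funrpos_ge0 g) spE.
have Fn f' m' : future_free_ge0 k f' m' -> _ := fun H =>
  future_free_ge0_mul_noise indep kT H mgn (funrneg_ge0 g) snE.
exists (fun om => f1 om * g^\+ (w k om) + f2 om * g^\- (w k om))%R.
exists (fun om => f1 om * g^\- (w k om) + f2 om * g^\+ (w k om))%R.
exists (m1 * sp + m2 * sn)%R, (m1 * sn + m2 * sp)%R; split.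
- exact: future_free_ge0D (Fp _ _ fm1) (Fn _ _ fm2).
- exact: future_free_ge0D (Fn _ _ fm1) (Fp _ _ fm2).
- by apply/funext => om /=; rewrite fE gpn /=; ring.
- by rewrite mE sE; ring.
Qed.

Lemma future_free_cst c : future_free 0 (cst c) c.
Proof.
have H (c' : R) : (0 <= c')%R -> future_free_ge0 0 (cst c') c'.
  move=> c0; split => // B mB; 
  by rewrite (integral_cst Pr (measurable_future_event _ mB) c'%:E).
exists (cst (Num.max c 0%R)), (cst (Num.max (- c) 0)%R).
exists (Num.max c 0%R), (Num.max (- c) 0)%R; split.
- by apply: H; rewrite le_max lexx orbT.
- by apply: H; rewrite le_max lexx orbT.
- by apply/funext => om /=; rewrite /Num.max; do 2 case: ifPn; lra.
- by rewrite /Num.max; do 2 case: ifPn; lra.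
Qed.

End future_free.

(** * Quadratic forms and positive definite matrices *)

Section quadratic_forms.
Context {R : realType}.

Lemma symmetricmxE n (M : 'M[R]_n) : (M \is symmetricmx) = (M == M^T).
Proof.
rewrite is_hermitianmxE expr0 scale1r (_ : map_mx _ _ = M^T)//.
by apply/matrixP => i j; rewrite !mxE.
Qed.

Lemma qformD n (M N : 'M[R]_n) x : qform (M + N) x = qform M x + qform N x.
Proof. by rewrite /qform mulmxDr mulmxDl mxE. Qed.

Lemma qformB n (M N : 'M[R]_n) x : qform (M - N) x = qform M x - qform N x.
Proof. by rewrite /qform mulmxBr mulmxBl !mxE. Qed.

Lemma qformZ n a (M : 'M[R]_n) x : qform (a *: M) x = a * qform M x.
Proof. by rewrite /qform -scalemxAr -scalemxAl mxE. Qed.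

Lemma qform0 n (M : 'M[R]_n) : qform M 0 = 0.
Proof. by rewrite /qform mulmx0 mxE. Qed.

Lemma qform_scale n (M : 'M[R]_n) a x : qform M (a *: x) = a ^+ 2 * qform M x.
Proof.
by rewrite /qform -scalemxAr [(a *: x)^T]linearZ/= -!scalemxAl !mxE mulrA.
Qed.

Lemma qform_congr m n (M : 'M[R]_m) (B : 'M[R]_(m, n)) x :
  qform M (B *m x) = qform (B^T *m M *m B) x.
Proof. by rewrite /qform trmx_mul !mulmxA. Qed.

Lemma qform_addmul m n (Q : 'M[R]_m) (B D : 'M[R]_(m, n)) (t : R) x :
  qform Q (B *m x + t *: (D *m x)) =
  qform (B^T *m Q *m B) x + qform (B^T *m Q *m D + D^T *m Q *m B) x * t
  + qform (D^T *m Q *m D) x * t ^+ 2.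
Proof.
rewrite -qform_congr -(qform_congr Q D) qformD.
rewrite /qform [(_ + _)^T]linearD/= [(t *: _)^T]linearZ/= !trmx_mul.
rewrite !mulmxDl !mulmxDr.
rewrite -!scalemxAl -!scalemxAr !mulmxA !mxE; ring.
Qed.

Lemma posdef_unitmx n (M : 'M[R]_n) : posdef M -> M \in unitmx.
Proof.
move=> [_ pM]; rewrite -row_free_unit -kermx_eq0; apply/rowV0P => v.
move=> /sub_kermxP vM; apply/eqP; rewrite -trmx_eq0; apply/negP => /negP/pM.
by rewrite /qform trmxK vM mul0mx mxE ltxx.
Qed.

Lemma posdef_tr n (M : 'M[R]_n) : posdef M -> M^T = M.
Proof. by case; rewrite symmetricmxE => /eqP. Qed.

Lemma posdef_inv n (M : 'M[R]_n) : posdef M -> posdef (invmx M).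
Proof.
move=> pM; have uM := posdef_unitmx pM; split.
  by rewrite symmetricmxE trmx_inv (posdef_tr pM).
move=> v v0; have := pM.2 (invmx M *m v).
rewrite qform_congr trmx_inv (posdef_tr pM) mulVmx// mul1mx; apply.
by apply: contra v0 => /eqP Mv; rewrite -(mulKVmx uM v) Mv mulmx0.
Qed.

(** Half of [posdef_congr_dual]. With [N = M G^-1 M'], [z = G^-1 M' y] and
[s = y' N y = z' G z], the hypothesis at [z] reads [(N y)' K (N y) < r s], and
expanding [0 <= |r K^-1 y - N y|_K^2] gives
[2 r s <= r^2 y' K^-1 y + (N y)' K (N y)]; together [s < r y' K^-1 y]. *)
Lemma posdef_dual m n (K : 'M[R]_m) (G : 'M[R]_n) (M : 'M[R]_(m, n)) (r : R) :
  posdef K -> posdef G -> 0 < r ->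
  posdef (r *: G - M^T *m K *m M) ->
  posdef (r *: invmx K - M *m invmx G *m M^T).
Proof.
move=> pK pG r0 [_ pD].
have uK := posdef_unitmx pK; have uG := posdef_unitmx pG.
have tK := posdef_tr pK; have tG := posdef_tr pG.
pose N := M *m invmx G *m M^T.
have tN : N^T = N by rewrite /N !trmx_mul trmxK trmx_inv tG mulmxA.
rewrite -/N; split.
  rewrite symmetricmxE [(_ - _)^T]linearB/= [(_ *: _)^T]linearZ/=.
  by rewrite trmx_inv tK tN.
move=> y y0; rewrite qformB qformZ subr_gt0.
pose z := invmx G *m M^T *m y.
set s := qform N y.
have Gz : qform G z = s.
  rewrite /z qform_congr trmx_mul trmxK trmx_inv tG -!mulmxA mulKmx//.
  by rewrite !mulmxA.
(* The strict hypothesis says nothing at [z = 0]; there [s] vanishes and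
   positivity comes from [K^-1]. *)
have [z0|z0] := eqVneq z 0.
  have -> : s = 0 by rewrite -Gz z0 qform0.
  by rewrite mulr_gt0//; apply: (posdef_inv pK).2.
have := pD _ z0; rewrite qformB qformZ Gz -qform_congr.
rewrite [M *m z](_ : _ = N *m y); last by rewrite /z /N !mulmxA.
have : 0 <= qform K ((r *: invmx K) *m y + (-1) *: (N *m y)).
  have [->|v0] := eqVneq ((r *: invmx K) *m y + (-1) *: (N *m y)) 0.
    by rewrite qform0.
  exact: (ltW (pK.2 _ v0)).
rewrite qform_addmul -(qform_congr K N).
have -> : (r *: invmx K)^T *m K *m (r *: invmx K) = r ^+ 2 *: invmx K.
  rewrite [(r *: _)^T]linearZ/= trmx_inv tK -scalemxAr -!scalemxAl mulVmx//.
  by rewrite mul1mx scalerA.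
have -> : (r *: invmx K)^T *m K *m N + N^T *m K *m (r *: invmx K) =
    (2 * r) *: N.
  rewrite [(r *: _)^T]linearZ/= trmx_inv tK -!scalemxAl mulVmx// mul1mx.
  rewrite -scalemxAr mulmxK// tN -scalerDl; congr (_ *: _); ring.
rewrite !qformZ -/s; set a := qform (invmx K) y; set b := qform K (N *m y).
move=> h1 h2; rewrite -(ltr_pM2l r0); nra.
Qed.

(** Exchanging [G] with [K^-1] and [M] with [M'] exchanges the two sides, so one
implication suffices. *)
Lemma posdef_congr_dual m n (K : 'M[R]_m) (G : 'M[R]_n) (M : 'M[R]_(m, n))
    (r : R) :
  posdef K -> posdef G -> 0 < r ->
  posdef (r *: G - M^T *m K *m M) <->
  posdef (r *: invmx K - M *m invmx G *m M^T).
Proof.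
move=> pK pG r0; split; first exact: posdef_dual.
move=> H; have := @posdef_dual _ _ (invmx G) (invmx K) M^T r.
rewrite !invmxK trmxK; apply => //; exact: posdef_inv.
Qed.

(** Both forms are homogeneous of degree two, so a bound on the ellipsoid is a
comparison of the forms. *)
Lemma ellipsoid_bound_posdef n (G M : 'M[R]_n) (c1 c2 : R) :
  0 < c1 -> 0 < c2 -> posdef G -> M^T = M ->
  (forall x, qform G x <= c1 -> qform M x < c2) <->
  posdef ((c2 / c1) *: G - M).
Proof.
move=> c10 c20 pG tM; split=> [H|[_ H] x Gx].
  split.
    rewrite symmetricmxE [(_ - _)^T]linearB/= [(_ *: _)^T]linearZ/= tM.
    by rewrite (posdef_tr pG).
  move=> x x0; have Gx := pG.2 _ x0; rewrite qformB qformZ subr_gt0.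
  have s0 : 0 < c1 / qform G x by rewrite divr_gt0.
  (* [x] rescaled to the boundary of the ellipsoid. *)
  have := H (Num.sqrt (c1 / qform G x) *: x).
  rewrite !qform_scale sqr_sqrtr ?(ltW s0)// divfK ?gt_eqF// => /(_ (lexx _)).
  by rewrite mulrAC ltr_pdivrMr// mulrAC ltr_pdivlMr// mulrC.
have [->|x0] := eqVneq x 0; first by rewrite qform0.
have := H _ x0; rewrite qformB qformZ subr_gt0 => /lt_le_trans; apply.
by rewrite mulrAC ler_pdivrMr// ler_pM2l.
Qed.

Lemma posdef_cast m m' (e : m = m') (M : 'M[R]_m) :
  posdef M -> posdef (castmx (e, e) M).
Proof. by case: m' / e; rewrite castmx_id. Qed.

Lemma posdef_block_diag m n (M : 'M[R]_m) (N : 'M[R]_n) :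
  posdef M -> posdef N -> posdef (block_mx M 0 0 N).
Proof.
move=> pM pN; split.
  by rewrite symmetricmxE tr_block_mx !trmx0 (posdef_tr pM) (posdef_tr pN).
move=> v; rewrite -[v]vsubmxK; set u1 := usubmx v; set u2 := dsubmx v.
have -> : qform (block_mx M 0 0 N) (col_mx u1 u2) = qform M u1 + qform N u2.
  rewrite /qform tr_col_mx mul_row_block !mulmx0 addr0 add0r mul_row_col.
  by rewrite mxE.
rewrite col_mx_eq0 negb_and.
have ge0 k (L : 'M[R]_k) u : posdef L -> 0 <= qform L u.
  move=> pL; have [->|u0] := eqVneq u 0; first by rewrite qform0.
  exact: (ltW (pL.2 _ u0)).
move=> /orP[u0|u0].
  by rewrite ltr_wpDr ?ge0//; apply: pM.2.
by rewrite ltr_wpDl ?ge0//; apply: pN.2.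
Qed.

End quadratic_forms.

(** * The stacked transition matrices *)

Section stacked_transitions.
Context {R : realType}.

Lemma castmx_mul_diag m m' p (e : m = m') (M : 'M[R]_m) (B : 'M[R]_(m, p)) :
  castmx (e, e) M *m castmx (e, erefl) B = castmx (e, erefl) (M *m B).
Proof. by case: m' / e; rewrite !castmx_id. Qed.

Lemma castmx_gram m m' p (e : m = m') (B D : 'M[R]_(m, p)) :
  (castmx (e, erefl) B)^T *m castmx (e, erefl) D = B^T *m D.
Proof. by case: m' / e; rewrite !castmx_id. Qed.

Lemma castmx_congr m m' p (e : m = m') (B : 'M[R]_(m, p)) (S : 'M[R]_p) :
  castmx (e, erefl) B *m S *m (castmx (e, erefl) B)^T =
  castmx (e, e) (B *m S *m B^T).
Proof. by case: m' / e; rewrite !castmx_id. Qed.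

Lemma kron_idM k n (M N : 'M[R]_n) :
  kron_id k M *m kron_id k N = kron_id k (M *m N).
Proof. by rewrite /kron_id tensmx_mul mul1mx. Qed.

Lemma kron_id_tr k n (M : 'M[R]_n) : (kron_id k M)^T = kron_id k M^T.
Proof. by rewrite /kron_id trmx_tens trmx1. Qed.

Lemma kron_id_1 k n : kron_id k (1%:M : 'M[R]_n) = 1%:M.
Proof.
apply/matrixP => i j; case: (mxtens_indexP i) => i0 i1.
case: (mxtens_indexP j) => j0 j1; rewrite tensmxE !mxE -natrM mulnb.
by rewrite (can_eq (@mxtens_indexK _ _)) -pair_eqE.
Qed.

Lemma kron_id_inv k n (M : 'M[R]_n) : M \in unitmx ->
  kron_id k (invmx M) = invmx (kron_id k M).
Proof.
move=> uM; have KI : kron_id k M *m kron_id k (invmx M) = 1%:M.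
  by rewrite kron_idM mulmxV// kron_id_1.
have [uK _] := mulmx1_unit KI.
by rewrite -[LHS](mulKmx uK) KI mulmx1.
Qed.

Lemma kron_id0 n (M : 'M[R]_n) :
  kron_id 0 M = castmx (pow2_0_dim n, pow2_0_dim n) M.
Proof.
rewrite /kron_id (tens_scalar1mx M).
by congr castmx; congr pair; exact: nat_irrelevance.
Qed.

(** The index of entry [(i, j)] being [i * n + j], the first [2^k n] indices are
those with [i < 2^k]; hence a block splitting, not an interleaving. *)
Lemma kron_idS k n (M : 'M[R]_n) :
  kron_id k.+1 M = castmx (pow2_S_dim k n, pow2_S_dim k n)
    (block_mx (kron_id k M) 0 0 (kron_id k M)).
Proof.
have cover l : exists l', l = cast_ord (pow2_S_dim k n) l'.
  by exists (cast_ord (esym (pow2_S_dim k n)) l); exact: val_inj.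
apply/matrixP => i j; rewrite castmxE; have [i' ->] := cover i.
have [j' ->] := cover j; rewrite !cast_ordK; move: i' j' {i j cover} => i j.
have dim_gt0 (l : 'I_(2 ^ k * n)) : (0 < n)%N.
  by case: n l {M i j} => // -[l]; rewrite muln0.
have divr (l : 'I_(2 ^ k * n)) : ((2 ^ k * n + l) %/ n = 2 ^ k + l %/ n)%N.
  by rewrite divnMDl// (dim_gt0 l).
have divl (l : 'I_(2 ^ k * n)) : (l %/ n < 2 ^ k)%N.
  by rewrite ltn_divLR ?(dim_gt0 l).
have modr (l : 'I_(2 ^ k * n)) :
    (mxtens_unindex (cast_ord (pow2_S_dim k n) (rshift _ l))).2 =
    (mxtens_unindex l).2.
  by apply: val_inj; rewrite /= modnMDl.
have modl (l : 'I_(2 ^ k * n)) :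
    (mxtens_unindex (cast_ord (pow2_S_dim k n) (lshift _ l))).2 =
    (mxtens_unindex l).2.
  exact: val_inj.
case: (split_ordP i) => i' ->; case: (split_ordP j) => j' ->.
- rewrite block_mxEul !mxE !modl; congr (_%:R * _).
- rewrite block_mxEur !mxE; rewrite -val_eqE/= divr.
  by rewrite ltn_eqF ?mul0r// ltn_addr.
- rewrite block_mxEdl !mxE; rewrite -val_eqE/= divr.
  by rewrite gtn_eqF ?mul0r// ltn_addr.
- rewrite block_mxEdr !mxE !modr; congr (_%:R * _).
  by rewrite -!val_eqE/= !divr eqn_add2l.
Qed.

Fixpoint word_stack n (A C : nat -> 'M[R]_n) (k : nat) :
    'M[R]_(2 ^ k * n, n) :=
  if k is k'.+1 then
    castmx (pow2_S_dim k' n, erefl)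
      (col_mx (kron_id k' (A k') *m word_stack A C k')
              (kron_id k' (C k') *m word_stack A C k'))
  else castmx (pow2_0_dim n, erefl) 1%:M.

(** Induction on [k] along [kron_idS] avoids any indexing of the blocks. *)
Lemma posdef_kron_id k n (M : 'M[R]_n) : posdef M -> posdef (kron_id k M).
Proof.
move=> pM; elim: k => [|k IHk]; first by rewrite kron_id0; exact: posdef_cast.
by rewrite kron_idS; apply: posdef_cast; exact: posdef_block_diag.
Qed.

(** The matrix of the form [x_0 |-> E x_k' Q x_k]. *)
Definition second_moment n (A C : nat -> 'M[R]_n) (k : nat) (Q : 'M[R]_n) :
    'M[R]_n :=
  (word_stack A C k)^T *m kron_id k Q *m word_stack A C k.

Lemma second_moment0 n (A C : nat -> 'M[R]_n) Q : second_moment A C 0 Q = Q.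
Proof.
rewrite /second_moment /= kron_id0 -mulmxA castmx_mul_diag castmx_gram.
by rewrite trmx1 mul1mx mulmx1.
Qed.

Lemma second_momentS n (A C : nat -> 'M[R]_n) k Q :
  second_moment A C k.+1 Q =
  second_moment A C k ((A k)^T *m Q *m A k) +
  second_moment A C k ((C k)^T *m Q *m C k).
Proof.
rewrite /second_moment [word_stack _ _ k.+1]/=.
rewrite kron_idS -mulmxA castmx_mul_diag castmx_gram.
rewrite tr_col_mx mul_block_col !mul0mx addr0 add0r mul_row_col.
by rewrite !trmx_mul !kron_id_tr -!kron_idM !mulmxA.
Qed.

Lemma lyap_step_word_stack n (A C : nat -> 'M[R]_n) k (S : 'M[R]_n) :
  lyap_step (A k) (C k) (word_stack A C k *m S *m (word_stack A C k)^T) =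
  word_stack A C k.+1 *m S *m (word_stack A C k.+1)^T.
Proof.
rewrite [word_stack _ _ k.+1]/= castmx_congr /lyap_step; congr castmx.
by rewrite mul_col_mx tr_col_mx mul_col_row !trmx_mul !kron_id_tr !mulmxA.
Qed.

Lemma lyap_initial n (A C : nat -> 'M[R]_n) (S : 'M[R]_n) :
  castmx (pow2_0_dim n, pow2_0_dim n) S =
  word_stack A C 0 *m S *m (word_stack A C 0)^T.
Proof. by rewrite /= castmx_congr trmx1 mul1mx mulmx1. Qed.

End stacked_transitions.

(** * Second moments of the state *)

Section second_moments.
Context (R : realType) (d : measure_display) (Omega : measurableType d)
  (Pr : probability Omega R) (T : nat) (w : nat -> {RV Pr >-> R})
  (w_noise : unit_white_noise T w).

Lemma integral_noise_sqr k : (k < T)%N ->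
  (\int[Pr]_om ((w k om) ^+ 2)%:E = 1)%E.
Proof.
case: w_noise => _ _ + kT => /(_ k k kT kT); rewrite eqxx unlock => <-.
by apply: eq_integral => om _; rewrite expr2.
Qed.

Lemma integrable_noise_sqr k : (k < T)%N ->
  Pr.-integrable setT (fun om => ((w k om) ^+ 2)%:E).
Proof.
move=> kT; apply/integrableP; split.
  by apply/measurable_EFinP; apply: measurable_funX; exact: measurable_funP.
under eq_integral do rewrite abse_EFin ger0_norm ?sqr_ge0//.
by rewrite integral_noise_sqr// ltry.
Qed.

(** Domination by [1 + w_k^2], integrable because [Pr] is finite. *)
Lemma integrable_noise k : (k < T)%N ->
  Pr.-integrable setT (fun om => (w k om)%:E).
Proof.
move=> kT.
have i1 : Pr.-integrable setT (fun om => (1 + (w k om) ^+ 2)%:E).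
  under eq_fun do rewrite EFinD.
  apply: integrableD => //; last exact: integrable_noise_sqr.
  exact: finite_measure_integrable_cst.
apply: le_integrable i1 => //.
  by apply/measurable_EFinP; exact: measurable_funP.
move=> om _; rewrite !abse_EFin lee_fin [X in _ <= X]ger0_norm; last first.
  by rewrite addr_ge0// sqr_ge0.
by rewrite ler_norml; apply/andP; split; nra.
Qed.

Lemma integral_noise k : (k < T)%N -> (\int[Pr]_om (w k om)%:E = 0)%E.
Proof. by case: w_noise => _ + _ kT => /(_ k kT); rewrite unlock. Qed.

(** Quantifying over all [Q] makes the induction go through: a quadratic form of
[x_(k+1)] is a polynomial of degree two in [w_k] whose coefficients are
quadratic forms of [x_k], and [w_k] has moments [1, 0, 1]. *)
Lemma state_future_free n (A C : nat -> 'M[R]_n) x0 k Q : (k <= T)%N ->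
  future_free T w k (fun om => qform Q (state A C w x0 k om))
    (qform (second_moment A C k Q) x0).
Proof.
have [indep _ _] := w_noise; elim: k Q => [|k IHk] Q kT.
  rewrite second_moment0.
  exact: (@future_free_cst _ _ _ Pr T w (qform Q x0)).
have mul g s Q' := @future_free_mul_noise _ _ _ Pr T w k _ _ g s indep kT
  (IHk Q' (ltnW kT)).
rewrite second_momentS qformD.
rewrite (_ : (fun om => _) = (fun om =>
    qform ((A k)^T *m Q *m A k) (state A C w x0 k om) * 1 +
    qform ((A k)^T *m Q *m C k + (C k)^T *m Q *m A k) (state A C w x0 k om) *
      w k om) \+ (fun om =>
    qform ((C k)^T *m Q *m C k) (state A C w x0 k om) * w k om ^+ 2));
    last first.
  by apply/funext => om /=; rewrite qform_addmul mulr1.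
apply: future_freeD; last first.
  rewrite -[X in future_free _ _ _ _ X]mulr1.
  apply: (mul (fun r => r ^+ 2)) => //.
  - exact: integrable_noise_sqr.
  - exact: integral_noise_sqr.
rewrite -[X in future_free _ _ _ _ X]addr0; apply: future_freeD.
  rewrite -[X in future_free _ _ _ _ X]mulr1.
  apply: (mul (fun=> 1)) => //.
  - exact: finite_measure_integrable_cst.
  - by rewrite (integral_cst Pr measurableT 1%E) mul1e; exact: probability_setT.
rewrite -(mulr0 (qform (second_moment A C k
  ((A k)^T *m Q *m C k + (C k)^T *m Q *m A k)) x0)).
apply: (mul id) => //; first exact: integrable_noise.
exact: integral_noise.
Qed.

Lemma state_second_moment n (A C : nat -> 'M[R]_n) x0 k Q : (k <= T)%N ->
  ('E_Pr[fun om => qform Q (state A C w x0 k om)] =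
   (qform (second_moment A C k Q) x0)%:E)%E.
Proof.
by move=> kT; exact: future_free_expectation (state_future_free _ _ _ _ kT).
Qed.

End second_moments.

(** * The criterion for finite-time stability *)

Theorem theorem2 (R : realType) (d : measure_display) (Omega : measurableType d)
    (Pr : probability Omega R) (Pr_complete : measure_is_complete Pr)
    (n T : nat) (T_ge1 : (1 <= T)%N)
    (c1 c2 : R) (c1_gt0 : 0 < c1) (c1_le_c2 : c1 <= c2)
    (W : nat -> 'M[R]_n) (W_posdef : forall k, (k <= T)%N -> posdef (W k))
    (A C : nat -> 'M[R]_n)
    (w : nat -> {RV Pr >-> R}) (w_noise : unit_white_noise T w) :
  finite_time_stable Pr (state A C w) c1 c2 T W <->
  exists P : forall k : nat, 'M[R]_(2 ^ k * n),
    [/\ forall k, (k <= T)%N -> P k \is symmetricmx,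
        P 0%N = castmx (pow2_0_dim n, pow2_0_dim n) (invmx (W 0%N)),
        forall k, (k < T)%N -> P k.+1 = lyap_step (A k) (C k) (P k) &
        forall k, (k <= T)%N ->
          loewner_lt (P k) ((c2 / c1) *: kron_id k (invmx (W k)))].
Proof.
have c2_gt0 : 0 < c2 by exact: lt_le_trans c1_le_c2.
have W0 := W_posdef 0%N isT.
pose Psol k := word_stack A C k *m invmx (W 0%N) *m (word_stack A C k)^T.
have Psol_sym k : Psol k \is symmetricmx.
  rewrite symmetricmxE /Psol !trmx_mul trmxK (posdef_tr (posdef_inv W0)).
  by rewrite mulmxA.
have stable_at k : (k <= T)%N ->
    (forall x0, qform (W 0%N) x0 <= c1 ->
       ('E_Pr[fun om => qform (W k) (state A C w x0 k om)] < c2%:E)%E) <->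
    loewner_lt (Psol k) ((c2 / c1) *: kron_id k (invmx (W k))).
  move=> kT; have pW := W_posdef k kT; have pK := posdef_kron_id k pW.
  rewrite /loewner_lt kron_id_inv ?posdef_unitmx//.
  rewrite -posdef_congr_dual ?divr_gt0// -ellipsoid_bound_posdef//; last first.
    by rewrite !trmx_mul trmxK (posdef_tr pK) mulmxA.
  by split=> H x /H; rewrite (state_second_moment w_noise)// lte_fin.
split=> [H|[P [_ P0 PS PT]]].
  exists Psol; split.
  - by [].
  - by rewrite (lyap_initial A C).
  - by move=> k _; rewrite lyap_step_word_stack.
  - by move=> k kT; apply/stable_at => // x /H; exact.
have PE k : (k <= T)%N -> P k = Psol k.
  elim: k => [_|k IHk kT]; first by rewrite P0 (lyap_initial A C).
  rewrite (PS _ kT) (IHk (ltnW kT)); exact: lyap_step_word_stack.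
move=> x Wx k kT; apply: (stable_at k kT).2 => //.
by rewrite -PE//; exact: PT.
Qed.
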